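(* Let $\mathcal{A}\in\mathbb{K}_l^{m\times r}$, $\mathcal{B}\in\mathbb{K}_l^{s\times n}$, $\mathcal{C}\in\mathbb{K}_l^{m\times n}$, let $\mathcal{M}\in\mathbb{K}_l^{r\times r}$ and $\mathcal{N}\in\mathbb{K}_l^{s\times s}$ be T-symmetric T-positive definite, let $\mathcal{S}_1,\dots,\mathcal{S}_{q_{\mathcal{S}}}\in\mathbb{K}_l^{m\times\tau}$, $\mathcal{V}_1,\dots,\mathcal{V}_{q_{\mathcal{V}}}\in\mathbb{K}_l^{n\times\zeta}$ be given sketching tubal matrices, and let $\mathbf{p}_{\mathcal{S}}\in\Delta_{q_{\mathcal{S}}}$, $\mathbf{p}_{\mathcal{V}}\in\Delta_{q_{\mathcal{V}}}$, $\theta\in[0,1]$. Let $$\mathcal{R}:=\mathbf{Range}\big(((\mathcal{N}^{-1})^{ST}*\mathcal{B}^{R})\otimes_t(\mathcal{M}^{-1}*\mathcal{A}^{T})\big).$$ Let $\mathcal{X}^{\star}$ satisfy $\mathcal{A}*\mathcal{X}^{\star}*\mathcal{B}=\mathcal{C}$. Let $\{\mathcal{X}^t\}_{t=1}^{\infty}$ be the iteration sequence calculated by the ATESP-CS method with initial iteration $\mathcal{X}^0$ satisfying $\mathrm{vec}_t(\mathcal{X}^{0})\in\mathcal{R}$: with $f_{i,j}(\mathcal{X})=\|\mathcal{A}*\mathcal{X}*\mathcal{B}-\mathcal{C}\|_{F(\mathcal{E}_i,\mathcal{G}_j)}^{2}$ and $$\mathfrak{W}_t=\Big\{(i,j): f_{i,j}(\mathcal{X}^t)\ge\theta\max_{v,w}f_{v,w}(\mathcal{X}^t)+(1-\theta)\,\mathbb{E}_{v\sim\mathbf{p}_{\mathcal{S}},w\sim\mathbf{p}_{\mathcal{V}}}[f_{v,w}(\mathcal{X}^t)]\Big\}$$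 (max over $1\le v\le q_{\mathcal{S}}$, $1\le w\le q_{\mathcal{V}}$; $v,w$ independent in the expectation), at step $t$ the pair $(i^t,j^t)$ is drawn equal to $(i,j)$ with probability $p_{i,j}^t=f_{i,j}(\mathcal{X}^t)/\sum_{(i',j')\in\mathfrak{W}_t}f_{i',j'}(\mathcal{X}^t)$ if $(i,j)\in\mathfrak{W}_t$ and $p_{i,j}^t=0$ otherwise, and $$\mathcal{X}^{t+1}=\mathcal{X}^{t}-\mathcal{M}^{-1}*\mathcal{A}^{T}*\mathcal{E}_{i^t}*(\mathcal{A}*\mathcal{X}^{t}*\mathcal{B}-\mathcal{C})*\mathcal{G}_{j^t}*\mathcal{B}^{T}*\mathcal{N}^{-1}.$$ Then $$\mathbb{E}[\|\mathcal{X}^{t}-\mathcal{X}^{\star}\|_{F(\mathcal{M},\mathcal{N})}^{2}\mid\mathcal{X}^{0}]\le\rho_{\text{ATESP-CS}}^{\,t}\,\|\mathcal{X}^{0}-\mathcal{X}^{\star}\|_{F(\mathcal{M},\mathcal{N})}^{2},\qquad \rho_{\text{ATESP-CS}}=1-\theta\,\delta_{\infty}^{2}-(1-\theta)\,\delta_{\mathbf{p}_{\mathcal{S}},\mathbf{p}_{\mathcal{V}}}^{2},$$ where $$\delta_{\infty}^{2}=\min_{0\neq\overrightarrow{\mathcal{Y}}\in\mathcal{R}}\ \max_{1\le i\le q_{\mathcal{S}},\,1\le j\le q_{\mathcal{V}}}\frac{\|((\mathcal{N}^{\frac12})^{ST}\otimes_t\mathcal{M}^{\frac12})*\overrightarrow{\mathcal{Y}}\|^{2}_{\mathcal{W}_j^{ST}\otimes_t\mathcal{Z}_i}}{\|\overrightarrow{\mathcal{Y}}\|^{2}_{\mathcal{N}^{ST}\otimes_t\mathcal{M}}},\qquad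 \delta_{\mathbf{p}_{\mathcal{S}},\mathbf{p}_{\mathcal{V}}}^{2}=\min_{0\neq\overrightarrow{\mathcal{Y}}\in\mathcal{R}}\frac{\|((\mathcal{N}^{\frac12})^{ST}\otimes_t\mathcal{M}^{\frac12})*\overrightarrow{\mathcal{Y}}\|^{2}_{\mathbb{E}_{j\sim\mathbf{p}_{\mathcal{V}}}[\mathcal{W}_j^{ST}]\otimes_t\mathbb{E}_{i\sim\mathbf{p}_{\mathcal{S}}}[\mathcal{Z}_i]}}{\|\overrightarrow{\mathcal{Y}}\|^{2}_{\mathcal{N}^{ST}\otimes_t\mathcal{M}}}.$$
   Context: Fix $l\ge 1$. $\mathbb{K}_l^{m\times n}=\mathbb{R}^{m\times n\times l}$ (tubal matrices), $\mathbb{K}_l^{m}=\mathbb{K}_l^{m\times 1}$. $\mathcal{A}_{(k)}$ is the $k$-th frontal slice $\mathcal{A}(:,:,k)$. $\mathrm{unfold}(\mathcal{A})$ is the block column with blocks $\mathcal{A}_{(1)},\dots,\mathcal{A}_{(l)}$, $\mathrm{fold}$ is its inverse, and $\mathrm{bcirc}(\mathcal{A})$ is the block circulant matrix whose first block column is $\mathrm{unfold}(\mathcal{A})$ (block $(p,q)$ is $\mathcal{A}_{(((p-q)\bmod l)+1)}$). The t-product is $\mathcal{A}*\mathcal{B}=\mathrm{fold}(\mathrm{bcirc}(\mathcal{A})\,\mathrm{unfold}(\mathcal{B}))$. The identity $\mathcal{I}_n$ has first frontal slice the identity matrix and other slices zero; $\mathcal{A}^{-1}$ is the two-sided inverse with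 respect to $*$. Transpose: $(\mathcal{A}^{T})_{(1)}=\mathcal{A}_{(1)}^{T}$, $(\mathcal{A}^{T})_{(k)}=\mathcal{A}_{(l-k+2)}^{T}$ for $k\ge2$. Slice transpose: $(\mathcal{A}^{ST})_{(k)}=\mathcal{A}_{(k)}^{T}$ for all $k$. Reverse: $(\mathcal{A}^{R})_{(1)}=\mathcal{A}_{(1)}$, $(\mathcal{A}^{R})_{(k)}=\mathcal{A}_{(l-k+2)}$ for $k\ge2$. $\mathcal{A}^{\dag}$ is the unique Moore–Penrose inverse (the four Penrose equations with $*$ and ${}^T$). $\langle\cdot,\cdot\rangle$ is the entrywise inner product. $\mathcal{M}$ is T-symmetric if $\mathcal{M}=\mathcal{M}^{T}$, and T-symmetric T-positive (semi)definite if moreover $\langle\overrightarrow{\mathcal{X}},\mathcal{M}*\overrightarrow{\mathcal{X}}\rangle>0$ for all nonzero $\overrightarrow{\mathcal{X}}$ (resp. $\ge0$ for all $\overrightarrow{\mathcal{X}}$). $\mathcal{M}^{\frac12}$ is defined by $\mathrm{bcirc}(\mathcal{M}^{\frac12})=\mathrm{bcirc}(\mathcal{M})^{\frac12}$, and $\mathcal{M}^{-\frac12}=(\mathcal{M}^{\frac12})^{-1}$. $\mathrm{vec}_t(\mathcal{A})\in\mathbb{K}_l^{mn}$ stacks vertically the lateral slices $\mathcal{A}_{(:,1,:)},\dots,\mathcal{A}_{(:,n,:)}$. $\mathcal{A}\otimes_t\mathcal{B}$ is the block tubal matrix with $(i,j)$ block $\mathcal{A}_{(i,j,:)}*\mathcal{B}$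 (the tube $\mathcal{A}_{(i,j,:)}\in\mathbb{K}_l^{1\times1}$ t-multiplied with every tube of $\mathcal{B}$). $\mathbf{Range}(\mathcal{A})=\{\mathcal{A}*\overrightarrow{\mathcal{X}}:\overrightarrow{\mathcal{X}}\in\mathbb{K}_l^{n}\}$. For T-symmetric T-positive semidefinite $\mathcal{D}$, $\|\overrightarrow{\mathcal{X}}\|_{\mathcal{D}}^2=\langle\mathcal{D}*\overrightarrow{\mathcal{X}},\overrightarrow{\mathcal{X}}\rangle$; for T-symmetric T-positive semidefinite $\mathcal{P},\mathcal{Q}$, $\|\mathcal{X}\|_{F(\mathcal{P},\mathcal{Q})}=\|\mathrm{vec}_t(\mathcal{X})\|_{\mathcal{Q}^{ST}\otimes_t\mathcal{P}}$. $\Delta_q$ is the set of probability vectors in $\mathbb{R}^q$; $i\sim\mathbf{p}$ means $i$ is drawn with probability $p_i$. For $i\in\{1,\dots,q_{\mathcal{S}}\}$, $j\in\{1,\dots,q_{\mathcal{V}}\}$: $\mathcal{E}_i=\mathcal{S}_i*(\mathcal{S}_i^{T}*\mathcal{A}*\mathcal{M}^{-1}*\mathcal{A}^{T}*\mathcal{S}_i)^{\dag}*\mathcal{S}_i^{T}$, $\mathcal{G}_j=\mathcal{V}_j*(\mathcal{V}_j^{T}*\mathcal{B}^{T}*\mathcal{N}^{-1}*\mathcal{B}*\mathcal{V}_j)^{\dag}*\mathcal{V}_j^{T}$, $\mathcal{Z}_i=\mathcal{M}^{-\frac12}*\mathcal{A}^{T}*\mathcal{E}_i*\mathcal{A}*\mathcal{M}^{-\frac12}$,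 $\mathcal{W}_j=\mathcal{N}^{-\frac12}*\mathcal{B}*\mathcal{G}_j*\mathcal{B}^{T}*\mathcal{N}^{-\frac12}$.
   Formalization: The solution X* is additionally required to satisfy vec_t(X* ) ∈ R; for an arbitrary solution of A*X*B=C the bound fails (e.g. l=1, A=[1 0], B=1, M, N, S, V identities, C=0, X^0=0, X*=(0,1)^T gives ρ=0 but error 1). *)

(* Defs.v *)
(* MathComp / MathComp-Analysis; the real numbers are an arbitrary realType. *)
From HB Require Import structures.
From mathcomp Require Export all_boot all_order all_algebra.
From mathcomp Require Export all_classical all_reals all_analysis.

Set Implicit Arguments.
Unset Strict Implicit.
Unset Printing Implicit Defensive.

Import Order.TTheory GRing.Theory Num.Theory.

Local Open Scope classical_set_scope.
Local Open Scope ring_scope.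

(* A tubal matrix is the family of its l frontal slices, indexed from 0:
   [A k] is the (k+1)-st frontal slice. Every operation below takes l to be of
   the form k.+1, so that 'I_l is Z/lZ and index arithmetic is cyclic.
   It is a notation so that the module structure of {ffun _ -> _} (entrywise
   addition and scaling) is found. *)
Notation tubal R l m n := ({ffun 'I_l -> 'M[R]_(m, n)}).

Declare Scope tubal_scope.
Delimit Scope tubal_scope with tub.
Reserved Notation "A *t B" (at level 40, left associativity).

Section TubalAlgebra.
Variables (R : realType) (k : nat).
Local Notation K m n := (tubal R k.+1 m n).

Definition tunfold m n (A : K m n) : 'M[R]_(\sum_(p < k.+1) m, n) :=
  \mxcol_(p < k.+1) A p.

Definition tfold m n (A : 'M[R]_(\sum_(p < k.+1) m, n)) : K m n :=
  [ffun p => submxcol A p].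

Definition bcirc m n (A : K m n) :
    'M[R]_(\sum_(p < k.+1) m, \sum_(q < k.+1) n) :=
  \mxblock_(p < k.+1, q < k.+1) A (p - q).

Definition tmul m n p (A : K m n) (B : K n p) : K m p :=
  tfold (bcirc A *m tunfold B).
Local Notation "A *t B" := (tmul A B).

Definition tid n : K n n := [ffun p => if p == 0 then 1%:M else 0].

(* With slices numbered from 0, the slice of index l - k + 2 (numbered from 1,
   k >= 2) is the one of index - k in Z/lZ, and - 0 = 0. *)
Definition ttr m n (A : K m n) : K n m := [ffun p => (A (- p))^T].
Definition tst m n (A : K m n) : K n m := [ffun p => (A p)^T].
Definition trev m n (A : K m n) : K m n := [ffun p => A (- p)].

(* [xget x0 P] is an element satisfying P, or x0 when there is none. The
   inverse, Moore-Penrose inverse and square roots below are unique when they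
   exist, so they are the intended objects whenever these exist. *)
Definition is_tinv n (A X : K n n) : Prop :=
  A *t X = tid n /\ X *t A = tid n.
Definition tinv n (A : K n n) : K n n := xget 0 [set X | is_tinv A X].

Definition is_tpinv m n (A : K m n) (X : K n m) : Prop :=
  [/\ A *t X *t A = A, X *t A *t X = X,
      ttr (A *t X) = A *t X & ttr (X *t A) = X *t A].
Definition tpinv m n (A : K m n) : K n m := xget 0 [set X | is_tpinv A X].

Definition tdot m n (X Y : K m n) : R :=
  \sum_(p < k.+1) \sum_(i < m) \sum_(j < n) X p i j * Y p i j.

Definition tsym n (A : K n n) : Prop := A = ttr A.
Definition tposdef n (A : K n n) : Prop :=
  tsym A /\ forall X : K n 1, X != 0 -> 0 < tdot X (A *t X).

Definition is_psd_sqrt n (A S : 'M[R]_n) : Prop :=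
  [/\ S^T = S, forall x : 'cV[R]_n, 0 <= (x^T *m S *m x) 0 0 & S *m S = A].
Definition psd_sqrt n (A : 'M[R]_n) : 'M[R]_n :=
  xget 0 [set S | is_psd_sqrt A S].
Definition tsqrt n (A : K n n) : K n n :=
  xget 0 [set S | bcirc S = psd_sqrt (bcirc A)].
Definition tinvsqrt n (A : K n n) : K n n := tinv (tsqrt A).

Definition lateral m n (A : K m n) (j : 'I_n) : K m 1 :=
  [ffun p => col j (A p)].

(* The index set of size mn is written \sum_(j < n) m, as in the library's
   block matrices. *)
Definition vect m n (A : K m n) : K (\sum_(j < n) m) 1 :=
  [ffun p => \mxcol_(j < n) lateral A j p].

Definition tube m n (A : K m n) (i : 'I_m) (j : 'I_n) : K 1 1 :=
  [ffun p => (A p i j)%:M].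

Definition tube_mul m n (a : K 1 1) (B : K m n) : K m n :=
  [ffun p => \matrix_(i, j) (a *t tube B i j) p 0 0].

Definition tkron m n p q (A : K m n) (B : K p q) :
    K (\sum_(i < m) p) (\sum_(j < n) q) :=
  [ffun s => \mxblock_(i < m, j < n) tube_mul (tube A i j) B s].

Definition trange m n (A : K m n) : set (K m 1) :=
  [set A *t X | X in [set: K n 1]].

Definition sqnorm n (D : K n n) (X : K n 1) : R := tdot (D *t X) X.

Definition sqnormF m n (P : K m m) (Q : K n n) (X : K m n) : R :=
  sqnorm (tkron (tst Q) P) (vect X).

End TubalAlgebra.

Notation "A *t B" := (tmul A B) : tubal_scope.
Local Open Scope tubal_scope.

Definition prob_vector (R : realType) q (p : 'I_q -> R) : Prop :=
  (forall i, 0 <= p i) /\ \sum_i p i = 1.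

Section Sketching.
Variables (R : realType) (k m r s n tau zeta qS qV : nat).
Local Notation K m n := (tubal R k.+1 m n).
Variables (A : K m r) (B : K s n) (C : K m n) (M : K r r) (N : K s s).
Variables (S : 'I_qS -> K m tau) (V : 'I_qV -> K n zeta).
Variables (pS : 'I_qS -> R) (pV : 'I_qV -> R) (theta : R).

Definition calE (i : 'I_qS) : K m m :=
  S i *t tpinv (ttr (S i) *t A *t tinv M *t ttr A *t S i) *t ttr (S i).
Definition calG (j : 'I_qV) : K n n :=
  V j *t tpinv (ttr (V j) *t ttr B *t tinv N *t B *t V j) *t ttr (V j).
Definition calZ (i : 'I_qS) : K r r :=
  tinvsqrt M *t ttr A *t calE i *t A *t tinvsqrt M.
Definition calW (j : 'I_qV) : K s s :=
  tinvsqrt N *t B *t calG j *t ttr B *t tinvsqrt N.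

Definition calR : set (K (\sum_(j < s) r) 1) :=
  trange (tkron (tst (tinv N) *t trev B) (tinv M *t ttr A)).

Definition loss (i : 'I_qS) (j : 'I_qV) (X : K r s) : R :=
  sqnormF (calE i) (calG j) (A *t X *t B - C).

(* The losses, and the quotients in [delta_inf2], are nonnegative, so 0 is a
   harmless neutral element for the maxima. *)
Definition max_loss (X : K r s) : R :=
  \big[Order.max/0]_(v < qS) \big[Order.max/0]_(w < qV) loss v w X.
Definition mean_loss (X : K r s) : R :=
  \sum_(v < qS) \sum_(w < qV) pS v * pV w * loss v w X.

Definition capped (X : K r s) : {set 'I_qS * 'I_qV} :=
  [set ij | loss ij.1 ij.2 X >=
            theta * max_loss X + (1 - theta) * mean_loss X].

Definition capped_loss (X : K r s) : R :=
  \sum_(ij in capped X) loss ij.1 ij.2 X.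

Definition pair_prob (X : K r s) (ij : 'I_qS * 'I_qV) : R :=
  if ij \in capped X then loss ij.1 ij.2 X / capped_loss X else 0.

Definition step (ij : 'I_qS * 'I_qV) (X : K r s) : K r s :=
  X - tinv M *t ttr A *t calE ij.1 *t (A *t X *t B - C) *t calG ij.2
      *t ttr B *t tinv N.

(* A run of the method on a probability space: [idx t] is the pair drawn at
   step t and X t the t-th iterate. In [pair_drawn], H is the event that the
   first t draws are those of the outcome w; X t is constant on H, so the
   equation says that, conditionally on the first t draws, the next pair has
   law [pair_prob (X t)]. When [capped_loss (X t w)] is 0 the paper's
   probabilities read 0/0 and the draw is left unconstrained; all losses then
   vanish, so that no draw moves the iterate. *)
Record is_run d (T : measurableType d) (P : probability T R) (X0 : K r s)
    (idx : nat -> T -> 'I_qS * 'I_qV) (X : nat -> T -> K r s) : Prop := IsRun {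
  idx_measurable : forall t ij, measurable (idx t @^-1` [set ij]);
  run_start : forall w, X 0%N w = X0;
  run_step : forall t w, X t.+1 w = step (idx t w) (X t w);
  pair_drawn : forall t w ij, capped_loss (X t w) != 0 ->
    let H := [set w' | forall u, (u < t)%N -> idx u w' = idx u w] in
    P (H `&` idx t @^-1` [set ij]) = ((pair_prob (X t w) ij)%:E * P H)%E
}.

Definition halfMN : K (\sum_(j < s) r) (\sum_(j < s) r) :=
  tkron (tst (tsqrt N)) (tsqrt M).

(* The quotients are homogeneous of degree 0 and continuous away from 0, so
   when calR is not {0} both infima are attained, i.e. they are minima. *)
Definition delta_inf2 : R :=
  inf [set \big[Order.max/0]_(i < qS) \big[Order.max/0]_(j < qV)
        (sqnorm (tkron (tst (calW j)) (calZ i)) (halfMN *t Y)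
         / sqnorm (tkron (tst N) M) Y)
      | Y in calR `\ 0].

Definition delta_p2 : R :=
  inf [set sqnorm (tkron (\sum_(j < qV) pV j *: tst (calW j))
                         (\sum_(i < qS) pS i *: calZ i)) (halfMN *t Y)
           / sqnorm (tkron (tst N) M) Y
      | Y in calR `\ 0].

Definition rho : R := 1 - theta * delta_inf2 - (1 - theta) * delta_p2.

End Sketching.

(* Main.v *)
(* The error e of the iterate satisfies
     ||e'||^2 = ||e||^2 - f_ij(X)   in the norm F(M,N),
   because E A M^-1 A^T E = E and G B^T N^-1 B G = G make each correction an
   orthogonal projection of the error; in particular f_ij >= 0. Drawing the
   pair with probability proportional to f_ij on the set where f_ij exceeds
   the threshold makes the expected decrease at least the threshold, which
   dominates (theta delta_inf^2 + (1 - theta) delta_p^2) ||e||^2 since vec(e)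
   stays in the range of the Kronecker product. Every operator involved is
   written as X |-> P X Q through (Q^ST (x) P) vec(X) = vec(P X Q). *)
Require Import Defs.
From mathcomp Require Import ring measurable_realfun.

Set Implicit Arguments.
Unset Strict Implicit.
Unset Printing Implicit Defensive.

Import Order.TTheory GRing.Theory Num.Theory.
Local Open Scope classical_set_scope.
Local Open Scope ring_scope.
Local Open Scope tubal_scope.

(** * Tubal algebra *)

Section TubalAlgebra.
Variables (R : realType) (k : nat).
Local Notation K m n := (tubal R k.+1 m n).

Lemma sum_subr (V : nmodType) (p : 'I_k.+1) (F : 'I_k.+1 -> V) :
  \sum_q F (p - q) = \sum_q F q.
Proof.
rewrite [RHS](reindex_inj (h := fun q => p - q)) //.
by move=> x y /addrI /oppr_inj.
Qed.

Lemma sum_addr (V : nmodType) (p : 'I_k.+1) (F : 'I_k.+1 -> V) :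
  \sum_q F (q + p) = \sum_q F q.
Proof. by rewrite [RHS](reindex_inj (addIr p)). Qed.

Lemma sum_oppr (V : nmodType) (F : 'I_k.+1 -> V) :
  \sum_q F (- q) = \sum_q F q.
Proof. by rewrite [RHS](reindex_inj oppr_inj). Qed.

(** Block row [s] of the circulant times the unfolded column is a cyclic convolution. The ring laws
    of [tmul] below rest on this form and on its reindexed twin [tmulEr]. *)
Lemma tmulE m n p (A : K m n) (B : K n p) s :
  (A *t B) s = \sum_q A (s - q) *m B q.
Proof.
by rewrite /tmul /tfold ffunE /bcirc /tunfold mul_mxblock_mxrow mxcolK.
Qed.

Lemma tmulEr m n p (A : K m n) (B : K n p) s :
  (A *t B) s = \sum_q A q *m B (s - q).
Proof.
rewrite tmulE -[RHS](sum_subr s); apply: eq_bigr => q _.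
by rewrite subKr.
Qed.

Lemma tmulA m n p q (A : K m n) (B : K n p) (C : K p q) :
  A *t (B *t C) = A *t B *t C.
Proof.
apply/ffunP => s; rewrite tmulEr [RHS]tmulE.
under eq_bigr => u _ do rewrite tmulE mulmx_sumr.
rewrite exchange_big; apply: eq_bigr => v _ /=.
rewrite tmulEr mulmx_suml; apply: eq_bigr => u _.
by rewrite mulmxA addrAC.
Qed.

Lemma tmulDl m n p (A B : K m n) (C : K n p) : (A + B) *t C = A *t C + B *t C.
Proof.
apply/ffunP => s; rewrite [RHS]ffunE !tmulE -big_split; apply: eq_bigr => u _.
by rewrite ffunE mulmxDl.
Qed.

Lemma tmulDr m n p (A : K m n) (B C : K n p) : A *t (B + C) = A *t B + A *t C.
Proof.
apply/ffunP => s; rewrite [RHS]ffunE !tmulE -big_split; apply: eq_bigr => u _.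
by rewrite ffunE mulmxDr.
Qed.

Lemma tmul0l m n p (C : K n p) : (0 : K m n) *t C = 0.
Proof. by apply: (addrI (0 *t C)); rewrite -tmulDl !addr0. Qed.

Lemma tmul0r m n p (C : K m n) : C *t (0 : K n p) = 0.
Proof. by apply: (addrI (C *t 0)); rewrite -tmulDr !addr0. Qed.

Lemma tmulNl m n p (A : K m n) (C : K n p) : (- A) *t C = - (A *t C).
Proof. by apply: (addrI (A *t C)); rewrite -tmulDl !subrr tmul0l. Qed.

Lemma tmulNr m n p (A : K m n) (C : K n p) : A *t (- C) = - (A *t C).
Proof. by apply: (addrI (A *t C)); rewrite -tmulDr !subrr tmul0r. Qed.

Lemma tmulBl m n p (A B : K m n) (C : K n p) : (A - B) *t C = A *t C - B *t C.
Proof. by rewrite tmulDl tmulNl. Qed.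

Lemma tmulBr m n p (A : K m n) (B C : K n p) : A *t (B - C) = A *t B - A *t C.
Proof. by rewrite tmulDr tmulNr. Qed.

Lemma tmulZl m n p a (A : K m n) (C : K n p) : (a *: A) *t C = a *: (A *t C).
Proof.
apply/ffunP => s; rewrite [RHS]ffunE !tmulE scaler_sumr; apply: eq_bigr => u _.
by rewrite ffunE scalemxAl.
Qed.

Lemma tmulZr m n p a (A : K m n) (C : K n p) : A *t (a *: C) = a *: (A *t C).
Proof.
apply/ffunP => s; rewrite [RHS]ffunE !tmulE scaler_sumr; apply: eq_bigr => u _.
by rewrite ffunE scalemxAr.
Qed.

Lemma tmul_suml (I : Type) (r : seq I) m n p (F : I -> K m n) (C : K n p) :
  (\sum_(i <- r) F i) *t C = \sum_(i <- r) F i *t C.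
Proof.
apply: (big_morph (fun A => A *t C) (fun A B => tmulDl A B C)).
exact: tmul0l.
Qed.

Lemma tmul_sumr (I : Type) (r : seq I) m n p (F : I -> K n p) (C : K m n) :
  C *t (\sum_(i <- r) F i) = \sum_(i <- r) C *t F i.
Proof. by apply: (big_morph _ (tmulDr C)); rewrite tmul0r. Qed.

Lemma tmul1l m n (A : K m n) : tid R k m *t A = A.
Proof.
apply/ffunP => s; rewrite tmulE (bigD1 s) //= big1 ?addr0.
  by rewrite ffunE subrr eqxx mul1mx.
by move=> q qs; rewrite ffunE subr_eq0 eq_sym (negPf qs) mul0mx.
Qed.

Lemma tmul1r m n (A : K m n) : A *t tid R k n = A.
Proof.
apply/ffunP => s; rewrite tmulEr (bigD1 s) //= big1 ?addr0.
  by rewrite ffunE subrr eqxx mulmx1.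
by move=> q qs; rewrite ffunE subr_eq0 eq_sym (negPf qs) mulmx0.
Qed.

Lemma ttrK m n (A : K m n) : ttr (ttr A) = A.
Proof. by apply/ffunP => s; rewrite !ffunE opprK trmxK. Qed.

Lemma ttr0 m n : ttr (0 : K m n) = 0.
Proof. by apply/ffunP => s; rewrite !ffunE trmx0. Qed.

Lemma ttrM m n p (A : K m n) (B : K n p) : ttr (A *t B) = ttr B *t ttr A.
Proof.
apply/ffunP => s; rewrite ffunE tmulE tmulEr raddf_sum -[RHS]sum_oppr /=.
rewrite -[RHS](sum_oppr) -[LHS]sum_oppr; apply: eq_bigr => q _.
by rewrite trmx_mul !ffunE !opprK opprB addrC.
Qed.

Lemma ttr_id n : ttr (tid R k n) = tid R k n.
Proof.
apply/ffunP => s; rewrite !ffunE oppr_eq0.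
by case: ifP => _; rewrite ?trmx1 ?trmx0.
Qed.

Lemma tst0 m n : tst (0 : K m n) = 0.
Proof. by apply/ffunP => s; rewrite !ffunE trmx0. Qed.

Lemma tstD m n (A B : K m n) : tst (A + B) = tst A + tst B.
Proof. by apply/ffunP => s; rewrite !ffunE raddfD. Qed.

Lemma tstZ m n a (A : K m n) : tst (a *: A) = a *: tst A.
Proof. by apply/ffunP => s; rewrite !ffunE linearZ. Qed.

Lemma tstM m n p (A : K m n) (B : K n p) : tst (A *t B) = tst B *t tst A.
Proof.
apply/ffunP => s; rewrite ffunE tmulE tmulEr raddf_sum /=.
by apply: eq_bigr => q _; rewrite trmx_mul !ffunE.
Qed.

Lemma tst_ttr m n (A : K m n) : tst (ttr A) = trev A.
Proof. by apply/ffunP => s; rewrite !ffunE trmxK. Qed.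

(** * Inner product and adjoints *)

Lemma tdotE m n (X Y : K m n) : tdot X Y = \sum_p \tr ((X p)^T *m Y p).
Proof.
apply: eq_bigr => p _; rewrite /mxtrace exchange_big /=; apply: eq_bigr => i _.
by rewrite mxE; apply: eq_bigr => j _; rewrite !mxE.
Qed.

Lemma tdotC m n (X Y : K m n) : tdot X Y = tdot Y X.
Proof. by do 3![apply: eq_bigr => ? _]; rewrite mulrC. Qed.

Lemma tdotDl m n (X Y Z : K m n) : tdot (X + Y) Z = tdot X Z + tdot Y Z.
Proof.
rewrite /tdot -big_split; apply: eq_bigr => p _; rewrite -big_split.
apply: eq_bigr => i _; rewrite -big_split; apply: eq_bigr => j _ /=.
by rewrite !ffunE !mxE mulrDl.
Qed.

Lemma tdotZl m n a (X Z : K m n) : tdot (a *: X) Z = a * tdot X Z.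
Proof.
rewrite /tdot mulr_sumr; apply: eq_bigr => p _; rewrite mulr_sumr.
apply: eq_bigr => i _; rewrite mulr_sumr; apply: eq_bigr => j _ /=.
by rewrite !ffunE !mxE mulrA.
Qed.

Lemma tdotNl m n (X Z : K m n) : tdot (- X) Z = - tdot X Z.
Proof. by rewrite -scaleN1r tdotZl mulN1r. Qed.

Lemma tdotBl m n (X Y Z : K m n) : tdot (X - Y) Z = tdot X Z - tdot Y Z.
Proof. by rewrite tdotDl tdotNl. Qed.

Lemma tdotBr m n (X Y Z : K m n) : tdot Z (X - Y) = tdot Z X - tdot Z Y.
Proof. by rewrite ![tdot Z _]tdotC tdotBl. Qed.

Lemma tdot0l m n (X : K m n) : tdot 0 X = 0.
Proof. by rewrite -(subrr X) tdotBl subrr. Qed.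

(** This is why [ttr] reverses the slices: the adjoint of a convolution with index [s - q] has index
    [q - s]. *)
Lemma tdot_mull m n p (A : K m n) (X : K n p) (Y : K m p) :
  tdot (A *t X) Y = tdot X (ttr A *t Y).
Proof.
rewrite !tdotE.
under eq_bigr => s _ do rewrite tmulE raddf_sum mulmx_suml raddf_sum.
rewrite exchange_big; apply: eq_bigr => q _ /=.
rewrite tmulE mulmx_sumr raddf_sum; apply: eq_bigr => s _ /=.
by rewrite ffunE opprB trmx_mul mulmxA.
Qed.

Lemma tdot_mulr m n p (A : K n p) (X : K m n) (Y : K m p) :
  tdot (X *t A) Y = tdot X (Y *t ttr A).
Proof.
rewrite !tdotE.
under eq_bigr => s _ do rewrite tmulEr raddf_sum mulmx_suml raddf_sum.
rewrite exchange_big; apply: eq_bigr => q _ /=.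
rewrite tmulEr mulmx_sumr raddf_sum; apply: eq_bigr => s _ /=.
by rewrite ffunE opprB trmx_mul -mulmxA mxtrace_mulC mulmxA.
Qed.

(** * Vectorization and Kronecker products *)

Definition unvect m n (Y : K (\sum_(j < n) m) 1) : K m n :=
  [ffun p => \matrix_(i, j) submxcol (Y p) j i 0].

Lemma unvectK m n (Y : K (\sum_(j < n) m) 1) : vect (unvect Y) = Y.
Proof.
apply/ffunP => p; rewrite ffunE -[RHS]submxcolK; apply/eq_mxcol => j.
by apply/matrixP => i z; rewrite !ffunE !mxE (ord1 z).
Qed.

Lemma vectD m n (X Y : K m n) : vect (X + Y) = vect X + vect Y.
Proof.
apply/ffunP => p; rewrite !ffunE -mxcolD; apply/eq_mxcol => j.
by rewrite !ffunE raddfD.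
Qed.

Lemma vect_inj m n : injective (@vect R k m n).
Proof.
move=> X Y /ffunP e; apply/ffunP => p; apply/matrixP => i j.
have := e p; rewrite !ffunE => /eq_mxcolP /(_ j); rewrite !ffunE => /matrixP.
by move=> /(_ i 0); rewrite !mxE.
Qed.

Lemma vect0 m n : vect (0 : K m n) = 0.
Proof. by apply: (addrI (vect 0)); rewrite -vectD !addr0. Qed.

Lemma tdot_vect m n (X Y : K m n) : tdot (vect X) (vect Y) = tdot X Y.
Proof.
rewrite !tdotE; apply: eq_bigr => p _.
rewrite !ffunE tr_mxcol mul_mxrow_mxcol raddf_sum /=; apply: eq_bigr => j _.
by rewrite !ffunE /mxtrace big_ord1 !mxE; apply: eq_bigr => i _; rewrite !mxE.
Qed.

Lemma tube_mulE m n p q (A : K m n) (B : K p q) i j s :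
  tube_mul (tube A i j) B s = \sum_u A u i j *: B (s - u).
Proof.
apply/matrixP => a b; rewrite ffunE mxE tmulEr summxE summxE.
apply: eq_bigr => u _; rewrite !ffunE !mxE big_ord1 !mxE /=.
by rewrite !mulr1n.
Qed.

(** Tubes act as commuting scalars, so [Q] only has to exchange rows and columns, without reversing
    its slices: hence [tst] and not [ttr]. *)
Lemma tkron_vect m n p q (P : K m n) (Q : K p q) (X : K n p) :
  tkron (tst Q) P *t vect X = vect (P *t X *t Q).
Proof.
apply/ffunP => s; rewrite tmulE ffunE.
transitivity (\sum_(t < k.+1) \mxcol_(i < q) \sum_(j < p)
    (tube_mul (tube (tst Q) i j) P (s - t) *m lateral X j t)).
  by apply: eq_bigr => t _; rewrite !ffunE mul_mxblock_mxrow.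
rewrite -mxcol_sum; apply/eq_mxcol => i; rewrite ffunE tmulE.
(* The Kronecker side sums over the slices of [X] first; the double convolution is put in the same
   order. *)
have -> : \sum_u (P *t X) (s - u) *m Q u
   = \sum_t \sum_u P (s - t - u) *m X t *m Q u.
  under eq_bigr => u _ do rewrite tmulE mulmx_suml.
  rewrite exchange_big; apply: eq_bigr => t _; apply: eq_bigr => u _.
  by rewrite addrAC.
rewrite raddf_sum; apply: eq_bigr => t _ /=.
rewrite raddf_sum /=.
under eq_bigr => j _ do rewrite tube_mulE [lateral _ _ _]ffunE mulmx_suml.
rewrite exchange_big; apply: eq_bigr => u _ /=.
apply/matrixP => a b; rewrite summxE !mxE; apply: eq_bigr => j _.
rewrite -scalemxAl !mxE !ffunE !mxE mulrC; congr (_ * _).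
by apply: eq_bigr => v _; rewrite mxE.
Qed.

Lemma sqnorm_tkron m n (P : K m m) (Q : K n n) (X : K m n) :
  sqnorm (tkron (tst Q) P) (vect X) = tdot (P *t X *t Q) X.
Proof. by rewrite /sqnorm tkron_vect tdot_vect. Qed.

Lemma sqnormFE m n (P : K m m) (Q : K n n) (X : K m n) :
  sqnormF P Q X = tdot (P *t X *t Q) X.
Proof. exact: sqnorm_tkron. Qed.

End TubalAlgebra.

(** * Positivity and generalized inverses *)

Section PositiveDefinite.
Variable R : realType.

(* Peeling off the first row and column of [B] leaves its Schur complement,
   which is again positive definite, and a positive multiple of [v *m v^T]. *)
Lemma mxtrace_mul_psd n (A B : 'M[R]_n) :
  (forall x : 'cV_n, 0 <= (x^T *m A *m x) 0 0) ->
  B^T = B -> (forall x : 'cV_n, x != 0 -> 0 < (x^T *m B *m x) 0 0) ->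
  0 <= \tr (A *m B).
Proof.
elim: n A B => [|n IH] A B Apsd Bsym Bpd; first by rewrite /mxtrace big_ord0.
change 'M[R]_(1 + n) in A, B; change (0 <= \tr (A *m B)).
have {}Apsd (x : 'cV_(1 + n)) : 0 <= (x^T *m A *m x) 0 0 by exact: Apsd.
have {}Bpd (x : 'cV_(1 + n)) : x != 0 -> 0 < (x^T *m B *m x) 0 0 by exact: Bpd.
pose t := B 0 0.
pose v : 'cV[R]_(1 + n) := lsubmx B.
pose b : 'rV[R]_n := ursubmx B.
pose D : 'M[R]_n := drsubmx B - t^-1 *: (b^T *m b).
have ul : ulsubmx B = t%:M.
  rewrite [LHS]mx11_scalar; congr (_ %:M); rewrite !mxE.
  by have -> : lshift n 0 = 0 :> 'I_(1 + n) by apply: val_inj.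
have dl : dlsubmx B = b^T by rewrite /b trmx_ursub Bsym.
have vE : v = col_mx t%:M b^T.
  rewrite /v -[lsubmx B]vsubmxK -ul -dl.
  by congr col_mx; apply/matrixP => i j; rewrite !mxE.
(* [t] is the quadratic form of [B] at the first basis vector. *)
have t0 : 0 < t.
  have := Bpd (col_mx (1%:M : 'M[R]_1) 0); rewrite -[B]submxK tr_col_mx.
  rewrite mul_row_block mul_row_col trmx1 trmx0 !mul0mx !addr0 mulmx0 addr0.
  rewrite mul1mx mulmx1 ul.
  rewrite mxE eqxx mulr1n; apply.
  apply/eqP => /matrixP /(_ (lshift n 0) 0); rewrite col_mxEu !mxE eqxx.
  by move/eqP; rewrite oner_eq0.
have BE : B = t^-1 *: (v *m v^T) + block_mx 0 0 0 D.
  rewrite vE tr_col_mx mul_col_row scale_block_mx add_block_mx.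
  rewrite !addr0 -[LHS]submxK.
  congr block_mx; rewrite ?ul ?dl ?tr_scalar_mx ?trmxK.
  - by rewrite -scalar_mxM scale_scalar_mx mulKf ?gt_eqF.
  - by rewrite mul_scalar_mx scalerA mulVf ?scale1r ?gt_eqF.
  - by rewrite mul_mx_scalar scalerA mulVf ?scale1r ?gt_eqF.
  - by rewrite addrC subrK.
rewrite BE mulmxDr raddfD /= addr_ge0 //.
  rewrite -scalemxAr mxtraceZ mulr_ge0 ?invr_ge0 ?(ltW t0) //.
  by rewrite mulmxA mxtrace_mulC mulmxA trace_mx11.
rewrite -[A]submxK mulmx_block !mulmx0 !add0r mxtrace_block mxtrace0 add0r.
apply: IH.
- move=> x; have := Apsd (col_mx 0 x); rewrite -{1}[A]submxK tr_col_mx.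
  by rewrite mul_row_block mul_row_col trmx0 !mul0mx !add0r mulmx0 add0r.
- rewrite /D raddfB /= linearZ /= trmx_mul trmxK trmx_drsub Bsym //.
(* The first entry is chosen so that [v^T *m x = 0]; the form of [B] at [x] is then that of [D] at
   [z]. *)
move=> z z0; pose x := col_mx (- t^-1 *: (b *m z)) z.
have x0 : x != 0.
  apply: contra_neq z0 => xz; apply/matrixP => i j.
  move/matrixP: xz => /(_ (rshift 1 i) j).
  by rewrite col_mxEd => ->; rewrite !mxE.
have vx : v^T *m x = 0.
  rewrite vE tr_col_mx mul_row_col tr_scalar_mx trmxK mul_scalar_mx scalerA.
  by rewrite mulrN divff ?gt_eqF // scaleN1r addNr.
have := Bpd x x0; rewrite {1}BE mulmxDr mulmxDl -scalemxAr -scalemxAl.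
rewrite -!mulmxA vx !mulmx0 scaler0 add0r {1}/x tr_col_mx mulmxA mul_row_block.
by rewrite !mulmx0 !add0r /x mul_row_col mul0mx add0r mulmxA.
Qed.

End PositiveDefinite.

(** * Transfer to block circulant matrices *)

Section BlockCirculant.
Variables (R : realType) (k : nat).
Local Notation K m n := (tubal R k.+1 m n).

Lemma bcircM m n p (A : K m n) (B : K n p) :
  bcirc (A *t B) = bcirc A *m bcirc B.
Proof.
rewrite /bcirc mul_mxblock; apply: eq_mxblock => i j.
rewrite tmulE -(sum_addr (- j)); apply: eq_bigr => q _.
by rewrite opprB addrA subrK.
Qed.

Lemma bcirc_ttr m n (A : K m n) : bcirc (ttr A) = (bcirc A)^T.
Proof.
by rewrite /bcirc tr_mxblock; apply: eq_mxblock => i j; rewrite ffunE opprB.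
Qed.

Lemma bcirc_inj m n : injective (@bcirc R k m n).
Proof.
move=> A B; rewrite /bcirc => /eq_mxblockP e; apply/ffunP => p.
by have := e p 0; rewrite subr0.
Qed.

Lemma bcirc0 m n : bcirc (0 : K m n) = 0.
Proof. by rewrite -mxblock0; apply: eq_mxblock => i j; rewrite ffunE. Qed.

(** All diagonal blocks of a block circulant equal its first slice, and that of [ttr X *t Y] has
    trace [tdot X Y]; there are [k.+1] of them. *)
Lemma mxtrace_bcirc m n (X Y : K m n) :
  \tr ((bcirc X)^T *m bcirc Y) = k.+1%:R * tdot X Y.
Proof.
rewrite -bcirc_ttr -bcircM /bcirc mxtrace_mxblock.
under eq_bigr => i _ do rewrite subrr.
rewrite sumr_const card_ord mulr_natl; congr (_ *+ _).
rewrite tmulE raddf_sum tdotE; apply: eq_bigr => q _ /=.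
by rewrite ffunE sub0r opprK.
Qed.

Lemma tunfoldK m n : cancel (@tunfold R k m n) (@tfold R k m n).
Proof. by move=> A; apply/ffunP => p; rewrite ffunE mxcolK. Qed.

Lemma tfoldK m n : cancel (@tfold R k m n) (@tunfold R k m n).
Proof.
move=> A; rewrite /tunfold -[RHS]submxcolK; apply: eq_mxcol => p.
by rewrite ffunE.
Qed.

Lemma tunfoldM m n p (A : K m n) (B : K n p) :
  tunfold (A *t B) = bcirc A *m tunfold B.
Proof. exact: tfoldK. Qed.

Lemma tdot_tunfold m (X Y : K m 1) :
  tdot X Y = ((tunfold X)^T *m tunfold Y) 0 0.
Proof.
by rewrite /tunfold tr_mxcol mul_mxrow_mxcol tdotE -trace_mx11 raddf_sum.
Qed.

Lemma quad_bcirc m (M : K m m) (x : 'cV[R]_(\sum_(p < k.+1) m)) :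
  (x^T *m bcirc M *m x) 0 0 = tdot (tfold x) (M *t tfold x).
Proof. by rewrite tdot_tunfold tunfoldM !tfoldK mulmxA. Qed.

Lemma tposdef_bcirc m (M : K m m) : tposdef M ->
  forall x : 'cV_(\sum_(p < k.+1) m), x != 0 -> 0 < (x^T *m bcirc M *m x) 0 0.
Proof.
move=> [_ Mpd] x x0; rewrite quad_bcirc Mpd //.
apply: contra_neq x0 => /(congr1 (@tunfold R k m 1)); rewrite tfoldK => ->.
by rewrite -mxcol0; apply: eq_mxcol => p; rewrite ffunE.
Qed.

(** Up to the factor [k.+1] this is the trace of [(X^T M X) N] for the circulant images, a positive
    semidefinite matrix times a positive definite one. *)
Lemma tdot_ge0 m n (M : K m m) (N : K n n) (X : K m n) :
  tposdef M -> tposdef N -> 0 <= tdot (M *t X *t N) X.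
Proof.
move=> hM hN.
rewrite -(pmulr_rge0 _ (ltr0Sn R k)) tdotC -mxtrace_bcirc !bcircM !mulmxA.
apply: mxtrace_mul_psd (tposdef_bcirc hN); last first.
  by rewrite -bcirc_ttr; case: hN => <-.
move=> x; rewrite -!mulmxA mulmxA -trmx_mul mulmxA.
have [->|y0] := eqVneq (bcirc X *m x) 0; first by rewrite mulmx0 mxE.
by rewrite ltW ?tposdef_bcirc.
Qed.

Lemma bcirc_unitmx n (M : K n n) : tposdef M -> bcirc M \in unitmx.
Proof.
move=> hM; rewrite -row_free_unit; apply: inj_row_free => v vM0.
apply/eqP; apply: contraTT isT => v0.
have /(tposdef_bcirc hM) : v^T != 0.
  by apply: contra_neq v0 => e; rewrite -[v]trmxK e trmx0.
by rewrite trmxK vM0 mul0mx mxE ltxx.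
Qed.

(** * Inverses, pseudoinverses and square roots *)

Lemma is_tinv_unique n (A X Y : K n n) : is_tinv A X -> is_tinv A Y -> X = Y.
Proof.
by move=> [_ XA] [AY _]; rewrite -[X]tmul1r -AY tmulA XA tmul1l.
Qed.

Lemma tinv_eq n (A X : K n n) : is_tinv A X -> tinv A = X.
Proof.
move=> AX; rewrite /tinv; case: xgetP => [Y _ AY|/(_ X)//].
exact: is_tinv_unique AY AX.
Qed.

Lemma is_tinv_ttr n (A X : K n n) :
  tsym A -> is_tinv A X -> is_tinv A (ttr X).
Proof.
by rewrite /tsym => As [AX XA]; split; rewrite [in LHS]As -ttrM ?XA ?AX ttr_id.
Qed.

(** Solving a linear system with [bcirc M] gives a right inverse; since [M] is symmetric its
    transpose is a left inverse, and the two coincide. *)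
Lemma tposdef_tinv n (M : K n n) : tposdef M -> is_tinv M (tinv M).
Proof.
move=> hM; have [Ms _] := hM; suff [X MX] : exists X, is_tinv M X.
  by rewrite (tinv_eq MX).
pose X := tfold (invmx (bcirc M) *m tunfold (tid R k n)).
have MX : M *t X = tid R k n.
  apply: (can_inj (@tunfoldK n n)).
  by rewrite tunfoldM tfoldK mulKVmx ?bcirc_unitmx.
have XM : ttr X *t M = tid R k n by rewrite [Z in _ *t Z]Ms -ttrM MX ttr_id.
exists X; split => //.
by rewrite -(_ : ttr X = X) // -[LHS]tmul1r -MX tmulA XM tmul1l.
Qed.

Lemma tinv_sym n (A : K n n) : tsym A -> is_tinv A (tinv A) ->
  ttr (tinv A) = tinv A.
Proof. by move=> As AA; exact: is_tinv_unique (is_tinv_ttr As AA) AA. Qed.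

(** Penrose's argument: symmetry gives [AX = (AY)(AX) = (AX AY)^T = AY], likewise [XA = YA], and
    then [X = XAX = XAY = YAY = Y]. *)
Lemma is_tpinv_unique m n (A : K m n) X Y :
  is_tpinv A X -> is_tpinv A Y -> X = Y.
Proof.
move=> [X1 X2 X3 X4] [Y1 Y2 Y3 Y4].
have AXY : A *t X = A *t Y.
  by rewrite -{1}Y1 -tmulA -X3 -{1}Y3 -ttrM tmulA X1.
have XYA : X *t A = Y *t A.
  by rewrite -{1}Y1 -(tmulA A) tmulA -X4 -{1}Y4 -ttrM -tmulA (tmulA A X) X1.
by rewrite -X2 -tmulA AXY tmulA XYA.
Qed.

Lemma is_tpinv_ttr m n (A : K m n) X : is_tpinv A X -> is_tpinv (ttr A) (ttr X).
Proof.
by move=> [X1 X2 X3 X4]; split; rewrite -!ttrM ?tmulA ?X1 ?X2 ?X3 ?X4.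
Qed.

(* All the properties of the pseudoinverse below also hold for its default
   value [0], so its existence is never needed. *)
Lemma tpinv_cases m n (A : K m n) : is_tpinv A (tpinv A) \/ tpinv A = 0.
Proof. by rewrite /tpinv; case: xgetP => [X -> ?|_]; [left|right]. Qed.

Lemma tpinv_mulK m n (A : K m n) : tpinv A *t A *t tpinv A = tpinv A.
Proof. by case: (tpinv_cases A) => [[]//|->]; rewrite tmul0r. Qed.

Lemma tpinv_sym n (A : K n n) : tsym A -> ttr (tpinv A) = tpinv A.
Proof.
move=> As; case: (tpinv_cases A) => [h|->]; last exact: ttr0.
by apply: (is_tpinv_unique _ h); have := is_tpinv_ttr h; rewrite -As.
Qed.

(** Two defaults are nested: a default [psd_sqrt] makes [bcirc S] zero and hence [S] zero, so either
    failure ends in the first alternative. *)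
Lemma tsqrt_cases n (A : K n n) :
  tsqrt A = 0 \/ tsym (tsqrt A) /\ tsqrt A *t tsqrt A = A.
Proof.
rewrite /tsqrt; case: xgetP => [S _ /=|_]; last by left.
rewrite /psd_sqrt; case: xgetP => [Q -> [Qs _ QQ] SQ|_ S0].
  right; split; apply: bcirc_inj; first by rewrite bcirc_ttr SQ Qs.
  by rewrite bcircM SQ.
by left; apply: bcirc_inj; rewrite S0 bcirc0.
Qed.

Lemma tinvsqrt_props n (A : K n n) : tposdef A ->
    tsym (tsqrt A) -> tsqrt A *t tsqrt A = A ->
  [/\ tsqrt A *t tinvsqrt A = tid R k n, tinvsqrt A *t tsqrt A = tid R k n &
      ttr (tinvsqrt A) = tinvsqrt A].
Proof.
move=> hA Ss SS; have [AI IA] := tposdef_tinv hA.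
have h : is_tinv (tsqrt A) (tinvsqrt A).
  suff [X SX] : exists X, is_tinv (tsqrt A) X by rewrite /tinvsqrt (tinv_eq SX).
  (* With [S] the root, [S A^-1] is a right inverse of [S] and [A^-1 S] a left inverse, so they
     agree. *)
  have SX : tsqrt A *t (tsqrt A *t tinv A) = tid R k n by rewrite tmulA SS.
  exists (tsqrt A *t tinv A); split => //.
  have YS : tinv A *t tsqrt A *t tsqrt A = tid R k n by rewrite -tmulA SS.
  have <- : tinv A *t tsqrt A = tsqrt A *t tinv A.
    by rewrite -[LHS]tmul1r -SX tmulA YS tmul1l.
  exact: YS.
by have [? ?] := h; split => //; apply: tinv_sym.
Qed.

End BlockCirculant.

(** * One step of the method *)

Section SketchedProjection.
Variables (R : realType) (k m r s n : nat).
Local Notation K m n := (tubal R k.+1 m n).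

Lemma sketch_sym p tau (S : K p tau) (H : K tau tau) :
  tsym H -> ttr (S *t tpinv H *t ttr S) = S *t tpinv H *t ttr S.
Proof. by move=> Hs; rewrite !ttrM ttrK tpinv_sym // tmulA. Qed.

(** In [E Q E] the two pseudoinverses enclose exactly the matrix that they invert, so [tpinv_mulK]
    merges them. *)
Lemma sketch_mulK p tau (S : K p tau) (Q : K p p) :
  let E := S *t tpinv (ttr S *t Q *t S) *t ttr S in E *t Q *t E = E.
Proof.
move=> E; rewrite -[in RHS]/E [in RHS]/E -[tpinv _ in RHS]tpinv_mulK.
by rewrite /E !tmulA.
Qed.

Variables (A : K m r) (B : K s n) (M : K r r) (N : K s s).
Variables (E : K m m) (G : K n n).
Hypotheses (hM : tposdef M) (hN : tposdef N).
Hypotheses (Es : ttr E = E) (Gs : ttr G = G).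
Hypothesis EK : E *t (A *t tinv M *t ttr A) *t E = E.
Hypothesis GK : G *t (ttr B *t tinv N *t B) *t G = G.

(** The update made for the residual [Y]. For [Y = A e B] it is the projection of the error [e],
    orthogonal in the inner product weighted by [M] and [N]. *)
Let corr (Y : K m n) := tinv M *t ttr A *t E *t Y *t G *t ttr B *t tinv N.

Lemma weighted_corr Y : M *t corr Y *t N = ttr A *t (E *t Y *t G) *t ttr B.
Proof.
have [MI _] := tposdef_tinv hM; have [_ IN] := tposdef_tinv hN.
transitivity (M *t tinv M *t ttr A *t (E *t Y *t G) *t ttr B *t (tinv N *t N)).
  by rewrite /corr !tmulA.
by rewrite MI IN tmul1l tmul1r.
Qed.

(** In the weighted inner product, [corr] is [Y |-> E Y G] followed by the adjoint of
    [X |-> A X B]. *)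
Lemma tdot_corr Y (X : K r s) :
  tdot (M *t corr Y *t N) X = tdot (E *t Y *t G) (A *t X *t B).
Proof. by rewrite weighted_corr tdot_mulr tdot_mull !ttrK tmulA. Qed.

(** Apply [tdot_corr] to [corr Y] itself: [E] and [G] move to the other side, where [EK] and [GK]
    reduce [E (A (corr Y) B) G] to [E Y G]. *)
Lemma sqnormF_corr Y :
  tdot (M *t corr Y *t N) (corr Y) = tdot (E *t Y *t G) Y.
Proof.
rewrite tdot_corr -tmulA [LHS]tdot_mull tdot_mulr Es Gs tdotC; congr (tdot _ _).
transitivity (E *t (A *t tinv M *t ttr A) *t E *t Y *t
              (G *t (ttr B *t tinv N *t B) *t G)); last by rewrite EK GK !tmulA.
by rewrite /corr !tmulA.
Qed.

(** The energy is the squared weighted norm of the correction. *)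
Lemma energy_ge0 Y : 0 <= tdot (E *t Y *t G) Y.
Proof. by rewrite -sqnormF_corr tdot_ge0. Qed.

(** Pythagoras: the cross terms with [e] and the square of the correction all equal the energy,
    which is therefore subtracted twice and added once. *)
Lemma sqnormF_step (e : K r s) :
  tdot (M *t (e - corr (A *t e *t B)) *t N) (e - corr (A *t e *t B)) =
  tdot (M *t e *t N) e -
    tdot (E *t (A *t e *t B) *t G) (A *t e *t B).
Proof.
set Y := A *t e *t B; set U := corr Y.
have [[Ms _] [Ns _]] := (hM, hN).
have sym : tdot (M *t e *t N) U = tdot (M *t U *t N) e.
  by rewrite tdot_mulr tdot_mull -Ms -Ns tdotC tmulA.
have UU : tdot (M *t U *t N) U = tdot (E *t Y *t G) Y.
  exact: (sqnormF_corr Y).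
have Ue : tdot (M *t U *t N) e = tdot (E *t Y *t G) Y.
  exact: (tdot_corr Y e).
clearbody U; rewrite tmulBr tmulBl tdotBl !tdotBr sym UU Ue.
by ring.
Qed.

End SketchedProjection.

(** * Losses, the error norm and the range *)

Section Method.
Variables (R : realType) (k m r s n tau zeta qS qV : nat).
Local Notation K m n := (tubal R k.+1 m n).
Variables (A : K m r) (B : K s n) (C : K m n) (M : K r r) (N : K s s).
Variables (S : 'I_qS -> K m tau) (V : 'I_qV -> K n zeta).
Variables (pS : 'I_qS -> R) (pV : 'I_qV -> R) (theta : R).
Variable Xstar : K r s.
Hypotheses (hM : tposdef M) (hN : tposdef N).
Hypotheses (hpS : prob_vector pS) (hpV : prob_vector pV).
Hypothesis htheta : 0 <= theta <= 1.
Hypothesis hXstar : A *t Xstar *t B = C.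

Local Notation E := (calE A M S).
Local Notation G := (calG B N V).
Local Notation loss := (loss A B C M N S V).
Local Notation max_loss := (max_loss A B C M N S V).
Local Notation mean_loss := (mean_loss A B C M N S V pS pV).
Local Notation capped_loss := (capped_loss A B C M N S V pS pV theta).
Local Notation pair_prob := (pair_prob A B C M N S V pS pV theta).
Local Notation step := (step A B C M N S V).
Local Notation normF X := (sqnormF M N X).
Local Notation calR := (calR A B M N).
Local Notation delta_inf2 := (delta_inf2 A B M N S V).
Local Notation delta_p2 := (delta_p2 A B M N S V pS pV).
Local Notation rho := (rho A B M N S V pS pV theta).

Let energy i j (e : K r s) := tdot (E i *t (A *t e *t B) *t G j) (A *t e *t B).

Lemma calE_props i :
  ttr (E i) = E i /\ E i *t (A *t tinv M *t ttr A) *t E i = E i.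
Proof.
have [Ms _] := hM; have Is := tinv_sym Ms (tposdef_tinv hM).
rewrite /calE -!(tmulA (ttr (S i))) tmulA; split; last exact: sketch_mulK.
by apply: sketch_sym; rewrite /tsym !ttrM !ttrK Is !tmulA.
Qed.

Lemma calG_props j :
  ttr (G j) = G j /\ G j *t (ttr B *t tinv N *t B) *t G j = G j.
Proof.
have [Ns _] := hN; have Is := tinv_sym Ns (tposdef_tinv hN).
rewrite /calG -!(tmulA (ttr (V j))) tmulA; split; last exact: sketch_mulK.
by apply: sketch_sym; rewrite /tsym !ttrM !ttrK Is !tmulA.
Qed.

Lemma energy_nonneg i j e : 0 <= energy i j e.
Proof.
have [? ?] := calE_props i; have [? ?] := calG_props j.
exact: (energy_ge0 (A := A) (B := B) hM hN).
Qed.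

Lemma residualE X : A *t X *t B - C = A *t (X - Xstar) *t B.
Proof. by rewrite tmulBr tmulBl hXstar. Qed.

Lemma lossE i j X : loss i j X = energy i j (X - Xstar).
Proof. by rewrite /Defs.loss sqnormFE residualE. Qed.

Lemma loss_ge0 i j X : 0 <= loss i j X.
Proof. by rewrite lossE energy_nonneg. Qed.

Lemma normF_ge0 X : 0 <= normF X.
Proof. by rewrite sqnormFE tdot_ge0. Qed.

Lemma normF_step ij X :
  normF (step ij X - Xstar) = normF (X - Xstar) - loss ij.1 ij.2 X.
Proof.
rewrite lossE /step residualE addrAC !sqnormFE.
have [? ?] := calE_props ij.1; have [? ?] := calG_props ij.2.
exact: sqnormF_step.
Qed.

(** Since [trev B] is [tst (ttr B)], the left Kronecker factor is the [tst] of [ttr B *t tinv N],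
    and [tkron_vect] applies. *)
Lemma calRP (X : K r s) : calR (vect X) <->
  exists Z : K m n, X = tinv M *t ttr A *t Z *t (ttr B *t tinv N).
Proof.
rewrite /Defs.calR /trange -tst_ttr -tstM; split => [[Y _]|[Z ->]].
  by rewrite -(unvectK Y) tkron_vect => /vect_inj <-; exists (unvect Y).
by exists (vect Z) => //; rewrite tkron_vect.
Qed.

Lemma calR_sub X Y : calR (vect X) -> calR (vect Y) -> calR (vect (X - Y)).
Proof.
move=> /calRP [Z ->] /calRP [Z' ->]; apply/calRP; exists (Z - Z').
by rewrite tmulBr tmulBl.
Qed.

Lemma calR_step ij X : calR (vect X) -> calR (vect (step ij X)).
Proof.
move=> hX; apply: calR_sub => //; apply/calRP.
by exists (E ij.1 *t (A *t X *t B - C) *t G ij.2); rewrite !tmulA.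
Qed.

(** * Comparison of the losses with the two spectral constants *)

Lemma max_loss_ge i j X : loss i j X <= max_loss X.
Proof.
rewrite /Defs.max_loss; apply: le_trans (le_bigmax _ _ i).
exact: (le_bigmax _ (fun w => loss i w X) j).
Qed.

Lemma max_loss_ge0 X : 0 <= max_loss X.
Proof. exact: bigmax_ge_id. Qed.

Lemma mean_loss_le_max X : mean_loss X <= max_loss X.
Proof.
have [[pS0 pS1] [pV0 pV1]] := (hpS, hpV).
rewrite -[leRHS]mul1r -pS1 mulr_suml; apply: ler_sum => v _.
rewrite -[pS v]mulr1 -[in leRHS]pV1 mulr_sumr mulr_suml; apply: ler_sum => w _.
by rewrite mulr1 ler_wpM2l ?mulr_ge0 ?max_loss_ge.
Qed.

(* When one of the square roots is the default value [0], so is the weighted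
   quotient, and the resulting bound is trivial. *)
Lemma halfMN_energy e :
  (forall i j, sqnorm (tkron (tst (calW B N V j)) (calZ A M S i))
     (halfMN M N *t vect e) = 0) \/
  (forall i j, sqnorm (tkron (tst (calW B N V j)) (calZ A M S i))
     (halfMN M N *t vect e) = energy i j e).
Proof.
rewrite /halfMN tkron_vect.
case: (tsqrt_cases M) => [->|[SMs SM]].
  by left=> i j; rewrite !tmul0l sqnorm_tkron tmul0r tmul0l tdot0l.
case: (tsqrt_cases N) => [->|[SNs SN]].
  by left=> i j; rewrite !tmul0r sqnorm_tkron tmul0r tmul0l tdot0l.
right=> i j; rewrite sqnorm_tkron /calZ /calW /energy.
have [SI IS Is] := tinvsqrt_props hM SMs SM.
have [TJ JT Js] := tinvsqrt_props hN SNs SN.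
set I := tinvsqrt M in SI IS Is *; set J := tinvsqrt N in TJ JT Js *.
set P := tsqrt M in SI IS SMs *; set Q := tsqrt N in TJ JT SNs *.
set e' := P *t e *t Q; set H := E i; set F := G j.
(* The roots carried by [e'] cancel the inverse roots [I] and [J] inside [calZ] and [calW]. *)
have -> : I *t ttr A *t H *t A *t I *t e' *t (J *t B *t F *t ttr B *t J) =
    (I *t ttr A) *t (H *t (A *t e *t B) *t F) *t (ttr B *t J).
  transitivity (I *t ttr A *t H *t A *t (I *t P) *t e *t (Q *t J) *t
                B *t F *t ttr B *t J); first by rewrite /e' !tmulA.
  by rewrite IS TJ !tmul1r !tmulA.
rewrite tdot_mulr tdot_mull !ttrM !ttrK Is Js; congr (tdot _ _).
transitivity (A *t (I *t P) *t e *t (Q *t J) *t B); first by rewrite /e' !tmulA.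
by rewrite IS TJ !tmul1r.
Qed.

(** Both cases of [halfMN_energy] satisfy these bounds: the upper one compares the quotients with
    the losses, the lower one bounds the infimum's set from below. *)
Lemma quotient_le i j e :
  0 <= sqnorm (tkron (tst (calW B N V j)) (calZ A M S i))
     (halfMN M N *t vect e) <= energy i j e.
Proof.
by case: (halfMN_energy e) => ->; rewrite ?lexx ?energy_nonneg.
Qed.

Lemma delta_p_numerator e :
  sqnorm (tkron (\sum_(j < qV) pV j *: tst (calW B N V j))
                (\sum_(i < qS) pS i *: calZ A M S i)) (halfMN M N *t vect e)
  = \sum_i \sum_j pS i * pV j *
      sqnorm (tkron (tst (calW B N V j)) (calZ A M S i)) (halfMN M N *t vect e).
Proof.
have -> : \sum_(j < qV) pV j *: tst (calW B N V j)
    = tst (\sum_(j < qV) pV j *: calW B N V j).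
  rewrite (big_morph _ (@tstD _ _ _ _) (@tst0 _ _ _ _)).
  by apply: eq_bigr => j _; rewrite tstZ.
rewrite /halfMN tkron_vect sqnorm_tkron tmul_suml tmul_suml.
rewrite (big_morph (fun X => tdot X _) (fun X Y => tdotDl X Y _) (tdot0l _)).
apply: eq_bigr => i _; rewrite tmul_sumr.
rewrite (big_morph (fun X => tdot X _) (fun X Y => tdotDl X Y _) (tdot0l _)).
apply: eq_bigr => j _.
by rewrite sqnorm_tkron tmulZr !tmulZl !tdotZl mulrA [pV j * _]mulrC.
Qed.

(** Including [x = 0] makes nonnegativity of the weighted norm sufficient, without definiteness. *)
Lemma mul_le_of_le_div (a b x : R) :
  0 <= b -> 0 <= x -> a <= b / x -> a * x <= b.
Proof.
move=> b0; rewrite le_eqVlt => /orP[/eqP <-|x0]; first by rewrite mulr0.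
by rewrite ler_pdivlMr.
Qed.

Lemma delta_inf2_le X :
  calR (vect (X - Xstar)) -> delta_inf2 * normF (X - Xstar) <= max_loss X.
Proof.
set e := X - Xstar => he.
(* The infimum ranges over nonzero vectors only, so a zero error is treated apart. *)
have [->|e0] := eqVneq e 0.
  by rewrite sqnormFE tmul0r tmul0l tdot0l mulr0 max_loss_ge0.
have n0 : 0 <= sqnorm (tkron (tst N) M) (vect e) by exact: normF_ge0.
apply: mul_le_of_le_div; rewrite ?max_loss_ge0 ?normF_ge0 //.
set q := \big[Order.max/0]_(i < qS) \big[Order.max/0]_(j < qV)
  (sqnorm (tkron (tst (calW B N V j)) (calZ A M S i)) (halfMN M N *t vect e)
   / sqnorm (tkron (tst N) M) (vect e)).
apply: (@le_trans _ _ q).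
  (* The infimum is at most the quotient at [vect e], once the set is known to be bounded below,
     here by 0. *)
  apply: ge_inf; first by exists 0 => _ [Y _ <-]; exact: bigmax_ge_id.
  exists (vect e) => //; split => //= v0.
  by move/eqP: e0; apply; apply: vect_inj; rewrite v0 vect0.
apply: bigmax_le => [|i _]; first by rewrite divr_ge0 ?max_loss_ge0 ?normF_ge0.
apply: bigmax_le => [|j _]; first by rewrite divr_ge0 ?max_loss_ge0 ?normF_ge0.
rewrite ler_wpM2r ?invr_ge0 //; apply: le_trans (max_loss_ge i j X).
by rewrite lossE; case/andP: (quotient_le i j e).
Qed.

Lemma delta_p2_le X :
  calR (vect (X - Xstar)) -> delta_p2 * normF (X - Xstar) <= mean_loss X.
Proof.
set e := X - Xstar => he.
have [[pS0 pS1] [pV0 pV1]] := (hpS, hpV).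
have mean0 : 0 <= mean_loss X.
  apply: sumr_ge0 => i _; apply: sumr_ge0 => j _.
  by rewrite !mulr_ge0 ?loss_ge0.
have [->|e0] := eqVneq e 0.
  by rewrite sqnormFE tmul0r tmul0l tdot0l mulr0.
have n0 : 0 <= sqnorm (tkron (tst N) M) (vect e) by exact: normF_ge0.
apply: mul_le_of_le_div; rewrite ?normF_ge0 //.
set q := sqnorm (tkron (\sum_(j < qV) pV j *: tst (calW B N V j))
                       (\sum_(i < qS) pS i *: calZ A M S i))
    (halfMN M N *t vect e) / sqnorm (tkron (tst N) M) (vect e).
apply: (@le_trans _ _ q).
  apply: ge_inf; last first.
    exists (vect e) => //; split => //= v0.
    by move/eqP: e0; apply; apply: vect_inj; rewrite v0 vect0.
  (* Lower bound of the set: every [Y] is a [vect], so its numerator is an average of nonnegative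
     terms. *)
  exists 0 => _ [Y _ <-]; rewrite -(unvectK Y) divr_ge0 //.
    2: exact: normF_ge0.
  rewrite delta_p_numerator; apply: sumr_ge0 => i _; apply: sumr_ge0 => j _.
  by rewrite !mulr_ge0 //; case/andP: (quotient_le i j (unvect Y)).
rewrite ler_wpM2r ?invr_ge0 // delta_p_numerator.
apply: ler_sum => i _; apply: ler_sum => j _; rewrite ler_wpM2l ?mulr_ge0 //.
by rewrite lossE; case/andP: (quotient_le i j e).
Qed.

(** * The threshold and the capped sampling rule *)

Lemma threshold_ge X : calR (vect (X - Xstar)) ->
  (1 - rho) * normF (X - Xstar)
    <= theta * max_loss X + (1 - theta) * mean_loss X.
Proof.
move=> he; have [t0 t1] := andP htheta.
have -> : (1 - rho) * normF (X - Xstar) =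
    theta * (delta_inf2 * normF (X - Xstar)) +
    (1 - theta) * (delta_p2 * normF (X - Xstar)) by rewrite /Defs.rho; ring.
by apply: lerD; rewrite ler_wpM2l ?subr_ge0 ?delta_inf2_le ?delta_p2_le.
Qed.

Lemma threshold_le X :
  theta * max_loss X + (1 - theta) * mean_loss X <= max_loss X.
Proof.
have [t0 t1] := andP htheta.
rewrite [leRHS](_ : _ = theta * max_loss X + (1 - theta) * max_loss X).
  2: by ring.
by rewrite lerD2l ler_wpM2l ?subr_ge0 ?mean_loss_le_max //.
Qed.

(** The threshold lies between [(1 - rho) ||e||^2] and the largest loss, and no loss exceeds
    [||e||^2], because the squared norm after a step is nonnegative. *)
Lemma rho_normF_ge0 X : calR (vect (X - Xstar)) -> 0 <= rho * normF (X - Xstar).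
Proof.
move=> he; have := le_trans (threshold_ge he) (threshold_le X).
have : max_loss X <= normF (X - Xstar).
  apply: bigmax_le => [|i _]; first exact: normF_ge0.
  apply: bigmax_le => [|j _]; first exact: normF_ge0.
  by rewrite -subr_ge0 -(normF_step (i, j)) normF_ge0.
by move=> h1 h2; have := le_trans h2 h1; rewrite mulrBl mul1r lerBlDr lerDl.
Qed.

(** Were the maximum positive, every loss would be strictly below it: losses in the capped set
    vanish, the others are under the threshold, itself at most the maximum. *)
Lemma capped_loss0 X : capped_loss X = 0 -> max_loss X = 0.
Proof.
move/psumr_eq0P => c0; apply/eqP; rewrite eq_le max_loss_ge0 andbT leNgt.
apply/negP => m0; suff: max_loss X < max_loss X by rewrite ltxx.
apply: bigmax_lt => // i _; apply: bigmax_lt => // j _.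
have [ijc|] := boolP ((i, j) \in capped A B C M N S V pS pV theta X).
  by rewrite (c0 _ (i, j)) // => ? _; exact: loss_ge0.
by rewrite inE -ltNge => /lt_le_trans; apply; exact: threshold_le.
Qed.

Lemma pair_prob_mean_loss X : capped_loss X != 0 ->
  theta * max_loss X + (1 - theta) * mean_loss X <=
    \sum_ij loss ij.1 ij.2 X * pair_prob X ij.
Proof.
move=> c0; set thr := (X in X <= _).
rewrite (bigID (fun ij => ij \in capped A B C M N S V pS pV theta X)) /=.
rewrite [X in _ + X]big1 ?addr0; last first.
  by move=> ij /negPf nij; rewrite /Defs.pair_prob nij mulr0.
(* The factor 1 is spread as the sum of the probabilities over the capped set, so that the
   comparison is termwise. *)
rewrite -[thr]mulr1 -(divff c0) {1}/Defs.capped_loss mulr_suml mulr_sumr.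
apply: ler_sum => ij ijc; rewrite /Defs.pair_prob ijc.
rewrite ler_wpM2r ?divr_ge0 ?loss_ge0 //; last by move: ijc; rewrite inE.
by apply: sumr_ge0 => ? _; exact: loss_ge0.
Qed.

(** [w] holds unnormalized masses of total [h], meant as the joint probabilities of a fixed history
    and the next pair; null histories then cause no division by 0. *)
Lemma step_contraction X (w : 'I_qS * 'I_qV -> R) h :
  calR (vect (X - Xstar)) -> (forall ij, 0 <= w ij) -> \sum_ij w ij = h ->
  (capped_loss X != 0 -> forall ij, w ij = pair_prob X ij * h) ->
  \sum_ij normF (step ij X - Xstar) * w ij <= rho * normF (X - Xstar) * h.
Proof.
move=> he w0 wh wP.
have h0 : 0 <= h by rewrite -wh sumr_ge0.
under eq_bigr => ij _ do rewrite normF_step mulrBl.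
rewrite sumrB -mulr_sumr wh lerBlDr -lerBlDl.
rewrite [leLHS](_ : _ = (1 - rho) * normF (X - Xstar) * h); last by ring.
apply: le_trans (ler_wpM2r h0 (threshold_ge he)) _.
(* With zero capped loss the maximum, hence the threshold, is at most 0, and the bound holds for any
   masses. *)
have [c0|c0] := eqVneq (capped_loss X) 0.
  apply: (@le_trans _ _ 0).
    by rewrite mulr_le0_ge0 // -(capped_loss0 c0) threshold_le.
  by apply: sumr_ge0 => ij _; rewrite mulr_ge0 ?loss_ge0.
under eq_bigr => ij _ do rewrite wP // mulrA.
by rewrite -mulr_suml ler_wpM2r // pair_prob_mean_loss.
Qed.

End Method.

(** * Expectation along a run *)

Section FiniteValued.
Context d (T : measurableType d) (R : realType) (P : probability T R).
Variables (F : finType) (Z : T -> F).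
Hypothesis mZ : forall z, measurable (Z @^-1` [set z]).

Let bigsetU_fibers (D : set T) :
  \big[setU/set0]_(z <- enum F) (D `&` Z @^-1` [set z]) = D.
Proof.
rewrite -bigcup_seq; apply/seteqP; split => [x [z _ []//]|x Dx].
by exists (Z x) => //=; rewrite mem_enum.
Qed.

Lemma measurable_fiberwise (Y : set F) : measurable (Z @^-1` Y).
Proof.
rewrite -(bigsetU_fibers (Z @^-1` Y)); apply: bigsetU_measurable => z _.
have [Yz|nYz] := pselect (Y z).
  rewrite (_ : _ `&` _ = Z @^-1` [set z]) //.
  by apply/seteqP; split => [x []//|x /= xz]; split => //=; rewrite xz.
rewrite (_ : _ `&` _ = set0) //; apply/seteqP; split => // x [/= Yx xz].
by apply: nYz; rewrite -xz.
Qed.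

(** The integrand is constant on each of the finitely many fibers of [Z], which partition [D]. *)
Lemma integral_fiberwise (D : set T) (psi : F -> R) : measurable D ->
  (\int[P]_(w in D) (psi (Z w))%:E =
   (\sum_z psi z * fine (P (D `&` Z @^-1` [set z])))%:E)%E.
Proof.
move=> mD.
have mDZ z : measurable (D `&` Z @^-1` [set z]) by exact: measurableI.
rewrite -{1}(bigsetU_fibers D) integral_bigsetU_EFin ?enum_uniq //; last first.
- rewrite bigsetU_fibers; apply/measurable_EFinP => _ Y mY.
  by apply: measurableI => //; exact: (measurable_fiberwise (psi @^-1` Y)).
- apply/trivIsetP => i j _ _ /eqP ij; apply/seteqP; split => // x.
  by move=> [[_ /= xi] [_ /= xj]]; case: ij; rewrite -xi -xj.
rewrite big_enum /= -sumEFin; apply: eq_bigr => z _.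
rewrite EFinM fineK ?fin_num_measure //.
rewrite -integral_cst //; apply: eq_integral => w.
by rewrite inE => -[_ /= ->].
Qed.

Lemma measure_fiberwise (D : set T) : measurable D ->
  \sum_z fine (P (D `&` Z @^-1` [set z])) = fine (P D).
Proof.
move=> mD; have := integral_fiberwise (fun=> 1) mD.
rewrite integral_cst // mul1e => ->.
by apply: eq_bigr => z _; rewrite mul1r.
Qed.

Lemma expectation_fiberwise (psi : F -> R) :
  ('E_P[psi \o Z] = (\sum_z psi z * fine (P (Z @^-1` [set z])))%:E)%E.
Proof.
rewrite unlock integral_fiberwise //; congr EFin.
by apply: eq_bigr => z _; rewrite setTI.
Qed.

End FiniteValued.

(** * Expected error as a finite sum over histories of draws *)

Section Run.
Variables (R : realType) (k m r s n tau zeta qS qV : nat).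
Variables (A : tubal R k.+1 m r) (B : tubal R k.+1 s n) (C : tubal R k.+1 m n).
Variables (M : tubal R k.+1 r r) (N : tubal R k.+1 s s).
Variables (S : 'I_qS -> tubal R k.+1 m tau) (V : 'I_qV -> tubal R k.+1 n zeta).
Variables (pS : 'I_qS -> R) (pV : 'I_qV -> R) (theta : R).
Variables (Xstar X0 : tubal R k.+1 r s).
Context d (T : measurableType d) (P : probability T R).
Variables (idx : nat -> T -> 'I_qS * 'I_qV) (X : nat -> T -> tubal R k.+1 r s).
Hypotheses (hM : tposdef M) (hN : tposdef N).
Hypotheses (hpS : prob_vector pS) (hpV : prob_vector pV).
Hypothesis htheta : 0 <= theta <= 1.
Hypothesis hXstar : A *t Xstar *t B = C.
Hypothesis hXstarR : calR A B M N (vect Xstar).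
Hypothesis hX0 : calR A B M N (vect X0).
Hypothesis hrun : is_run A B C M N S V pS pV theta P X0 idx X.

Local Notation step := (step A B C M N S V).
Local Notation rho := (rho A B M N S V pS pV theta).

Definition iterate (h : seq ('I_qS * 'I_qV)) :=
  foldl (fun Y ij => step ij Y) X0 h.

(** The fixed length makes histories a finite type, as the fiberwise lemmas require. *)
Definition history t w : t.-tuple ('I_qS * 'I_qV) :=
  map_tuple (idx^~ w) (iota_tuple t 0).

Lemma iterate_history t w : X t w = iterate (history t w).
Proof.
elim: t => [|t IH]; first exact: run_start hrun w.
rewrite (run_step hrun) IH.
have -> : tval (history t.+1 w) = rcons (history t w) (idx t w).
  exact: mkseqS.
by rewrite /iterate foldl_rcons.
Qed.

Lemma calR_iterate h : calR A B M N (vect (iterate h)).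
Proof.
elim/last_ind: h => // h ij IH.
by rewrite /iterate foldl_rcons; apply: calR_step.
Qed.

(** Identifies the fibers with the conditioning event [H] of [pair_drawn]. *)
Lemma history_fiber t w : history t @^-1` [set history t w] =
  [set w' | forall u, (u < t)%N -> idx u w' = idx u w].
Proof.
apply/seteqP; split => w' /=.
  move=> /(congr1 val) /= /eq_in_map h u ut.
  by apply: h; rewrite mem_iota.
by move=> h; apply/val_inj/eq_in_map => u; rewrite mem_iota => /h.
Qed.

Lemma measurable_history t h : measurable (history t @^-1` [set h]).
Proof.
have [[w <-]|no] := pselect (exists w, history t w = h); last first.
  rewrite (_ : _ @^-1` _ = set0) //; apply/seteqP; split => // w /= wh.
  by apply: no; exists w.
rewrite history_fiber.
rewrite (_ : mkset _ = \bigcap_(u in `I_t) (idx u @^-1` [set idx u w])) //.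
apply: fin_bigcap_measurable => // u _.
exact: (idx_measurable hrun u (idx u w)).
Qed.

Local Notation err Y := (sqnormF M N (Y - Xstar)).

Let mean_err t := \sum_(h : t.-tuple ('I_qS * 'I_qV))
  err (iterate h) * fine (P (history t @^-1` [set h])).

Lemma expectation_err t :
  ('E_P[fun w => err (X t w)] = (mean_err t)%:E)%E.
Proof.
rewrite -(expectation_fiberwise P (@measurable_history t)
            (fun h => err (iterate h))).
by congr expectation; apply/funext => w /=; rewrite iterate_history.
Qed.

(** The history is paired with the next draw; for each history the joint masses meet the
    requirements of [step_contraction], and the bounds are summed. *)
Lemma mean_err_step t : mean_err t.+1 <= rho * mean_err t.
Proof.
pose Z w := (history t w, idx t w).
have fiberE h ij :
    Z @^-1` [set (h, ij)] = history t @^-1` [set h] `&` idx t @^-1` [set ij].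
  by apply/seteqP; split => w /=; [case=> -> ->|case=> <- <-].
have mZ z : measurable (Z @^-1` [set z]).
  case: z => h ij; rewrite fiberE; apply: measurableI.
    exact: measurable_history.
  exact: idx_measurable hrun t ij.
rewrite -lee_fin -expectation_err.
have -> : (fun w => err (X t.+1 w)) =
    (fun z : t.-tuple _ * _ => err (step z.2 (iterate z.1))) \o Z.
  by apply/funext => w; rewrite (run_step hrun) iterate_history.
rewrite (expectation_fiberwise P mZ) lee_fin.
rewrite [leLHS](_ : _ = \sum_(h : t.-tuple _) \sum_ij
    err (step ij (iterate h)) * fine (P (Z @^-1` [set (h, ij)]))); last first.
  by rewrite pair_bigA; apply: eq_bigr => -[h ij] _.
rewrite mulr_sumr; apply: ler_sum => h _; rewrite mulrA.
apply: (@step_contraction _ _ _ _ _ _ _ _ _ _ A B C M N S V pS pV theta) => //.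
- by apply: calR_sub => //; exact: calR_iterate.
- move=> ij; exact: fine_ge0.
- under eq_bigr => ij _ do rewrite fiberE.
  rewrite (measure_fiberwise P (idx_measurable hrun t)) //.
  exact: measurable_history.
move=> c0 ij; rewrite fiberE.
(* [pair_drawn] is stated at an outcome; a history that no outcome realizes has an empty fiber, and
   both sides are 0. *)
have [[w wh]|no] := pselect (exists w, history t w = h); last first.
  rewrite (_ : history t @^-1` _ = set0).
    by rewrite set0I measure0 mulr0.
  by apply/seteqP; split => // w /= wh; apply: no; exists w.
move: c0; rewrite -wh -iterate_history history_fiber => c0.
rewrite (pair_drawn hrun) // fineM // fin_num_measure // -history_fiber.
exact: measurable_history.
Qed.

Lemma mean_err_le t : mean_err t <= rho ^+ t * err X0.
Proof.
have [r0|r0] := leP 0 rho.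
  elim: t => [|t IH]; last first.
    by rewrite exprS -mulrA (le_trans (mean_err_step t)) // ler_wpM2l.
  (* The factor 1 is replaced by the total mass of the fiber of the empty history. *)
  rewrite expr0; have <- : \sum_(h : 0.-tuple ('I_qS * 'I_qV))
      fine (P (setT `&` history 0 @^-1` [set h])) = 1.
    rewrite measure_fiberwise ?probability_setT //.
    exact: measurable_history.
  rewrite mulr_suml; apply: ler_sum => h _.
  by rewrite tuple0 setTI mulrC.
(* The induction multiplies by [rho], so a negative [rho] is handled apart: by [rho_normF_ge0] it
   forces all errors over [calR] to vanish. *)
have err0 Y : calR A B M N (vect Y) -> err Y = 0.
  move=> hY; have := normF_ge0 hM hN (Y - Xstar).
  rewrite le_eqVlt => /orP[/eqP //|Y0].
  have := rho_normF_ge0 S V hM hN hpS hpV htheta hXstar (calR_sub hY hXstarR).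
  by rewrite pmulr_lge0 // leNgt r0.
rewrite err0 // mulr0 [mean_err t]big1 // => h _.
by rewrite err0 ?mul0r //; exact: calR_iterate.
Qed.

End Run.

Theorem theorem6 (R : realType) (k m r s n tau zeta qS qV : nat)
    (A : tubal R k.+1 m r) (B : tubal R k.+1 s n) (C : tubal R k.+1 m n)
    (M : tubal R k.+1 r r) (N : tubal R k.+1 s s)
    (S : 'I_qS -> tubal R k.+1 m tau) (V : 'I_qV -> tubal R k.+1 n zeta)
    (pS : 'I_qS -> R) (pV : 'I_qV -> R) (theta : R)
    (Xstar X0 : tubal R k.+1 r s)
    (d : measure_display) (T : measurableType d) (P : probability T R)
    (idx : nat -> T -> 'I_qS * 'I_qV) (X : nat -> T -> tubal R k.+1 r s)
    (hM : tposdef M) (hN : tposdef N)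
    (hpS : prob_vector pS) (hpV : prob_vector pV)
    (htheta : 0 <= theta <= 1)
    (hXstar : A *t Xstar *t B = C)
    (hXstarR : calR A B M N (vect Xstar))
    (hX0 : calR A B M N (vect X0))
    (hrun : is_run A B C M N S V pS pV theta P X0 idx X) :
  forall t : nat,
    ('E_P[fun w => sqnormF M N (X t w - Xstar)%R]
      <= (rho A B M N S V pS pV theta ^+ t * sqnormF M N (X0 - Xstar))%:E)%E.
Proof.
move=> t; rewrite (expectation_err _ hrun) lee_fin.
exact: (mean_err_le (X := X)).
Qed.
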